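(* For every $n\in\mathbb{N}_0$ the set $$\{\,\alpha\in\mathcal{U}_n : \alpha\text{ is an ordinal}\,\}$$ is a countably infinite ordinal.
   Context: All sets are pure sets; the background theory is ZFC. For a set $A$ let $\mathcal{P}^0(A)=A$, $\mathcal{P}^{k}(A)=\mathcal{P}(\mathcal{P}^{k-1}(A))$ for $k\ge1$, and $\mathcal{SP}(A)=\bigcup_{k=0}^\infty\mathcal{P}^k(A)$, where $\mathcal{P}$ is the power set operation. Define $$V_{0,0}=\mathcal{SP}(\emptyset),\quad V_{n,k}=\mathcal{SP}(V_{n,k-1})\ (n\in\mathbb{N}_0,\ k\in\mathbb{N}),\quad \mathcal{U}_n=\bigcup_{k=0}^\infty V_{n,k}\ (n\in\mathbb{N}_0),\quad V_{n,0}=\mathcal{SP}(\mathcal{U}_{n-1})\ (n\in\mathbb{N}),$$ with $\mathbb{N}=\{1,2,3,\ldots\}$ and $\mathbb{N}_0=\mathbb{N}\cup\{0\}$. A set $U$ is transitive iff $Y\subseteq U$ for all $Y\in U$; an ordinal is a transitive set all of whose members are transitive. *)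

(* Defs.v *)
From HB Require Import structures.
From mathcomp Require Import all_boot.
From mathcomp Require Import boolp classical_sets functions cardinality.

Set Implicit Arguments.
Unset Strict Implicit.
Unset Printing Implicit Defensive.

Reserved Notation "x ∈ y" (at level 70, no associativity).
Reserved Notation "x ⊆ y" (at level 70, no associativity).

(* The universe of pure sets: well-founded trees (Aczel), quotiented by
   extensional equality, so that equality of sets is Leibniz equality. The ZFC
   axioms are proved below, with arbitrary predicates and relations in
   separation and replacement. *)
Inductive tree : Type := node (I : Type) (f : I -> tree).

Fixpoint bisim (s t : tree) : Prop :=
  match s, t with
  | node A f, node B g =>
      (forall i, exists j, bisim (f i) (g j)) /\
      (forall j, exists i, bisim (f i) (g j))
  end.

Lemma bisim_refl s : bisim s s.
Proof. by elim: s => I f IH; split=> i; exists i. Qed.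

Lemma bisim_sym s t : bisim s t -> bisim t s.
Proof.
elim: s t => I f IH [J g] [fg gf]; split=> [j|i].
  by have [i /IH] := gf j; exists i.
by have [j /IH] := fg i; exists j.
Qed.

Lemma bisim_trans s t u : bisim s t -> bisim t u -> bisim s u.
Proof.
elim: s t u => I f IH [J g] [K h] [fg gf] [gh hg]; split=> [i|k].
  by have [j fgij] := fg i; have [k /(IH _ _ _ fgij)] := gh j; exists k.
by have [j ghjk] := hg k; have [i /IH/(_ ghjk)] := gf j; exists i.
Qed.

HB.instance Definition _ := gen_eqMixin tree.
HB.instance Definition _ := gen_choiceMixin tree.

Definition bisimb (s t : tree) : bool := `[< bisim s t >].

Lemma bisimb_refl : reflexive bisimb.
Proof. by move=> s; apply/asboolP/bisim_refl. Qed.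

Lemma bisimb_sym : symmetric bisimb.
Proof. by move=> s t; apply/asboolP/asboolP => /bisim_sym. Qed.

Lemma bisimb_trans : transitive bisimb.
Proof.
by move=> t s u /asboolP st /asboolP tu; apply/asboolP/(bisim_trans st tu).
Qed.

Canonical bisim_equiv := EquivRel bisimb bisimb_refl bisimb_sym bisimb_trans.

Definition zfset : Type := {eq_quot bisim_equiv}%qT.

Definition tree_of (x : zfset) : tree := generic_quotient.repr x.
Definition of_tree (t : tree) : zfset := (\pi_({eq_quot bisim_equiv}) t)%qT.

Lemma tree_ofK x : of_tree (tree_of x) = x.
Proof. exact: reprK. Qed.

Lemma of_treeP s t : of_tree s = of_tree t <-> bisim s t.
Proof.
by split=> [/eqmodP/asboolP //|st]; apply/eqmodP/asboolP.
Qed.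

Definition idx (x : zfset) : Type :=
  match tree_of x with node A _ => A end.

Definition elem (x : zfset) : idx x -> zfset :=
  match tree_of x as t return match t with node A _ => A end -> zfset with
  | node A f => fun i => of_tree (f i)
  end.

Definition zmem (x y : zfset) : Prop := exists i : idx y, x = elem i.
Notation "x ∈ y" := (zmem x y).

Definition zsubset (x y : zfset) : Prop := forall z, z ∈ x -> z ∈ y.
Notation "x ⊆ y" := (zsubset x y).

(* The set {f i | i : I}. *)
Definition zfamily (I : Type) (f : I -> zfset) : zfset :=
  of_tree (node (fun i => tree_of (f i))).

Lemma mem_zfamily (I : Type) (f : I -> zfset) x :
  x ∈ zfamily f <-> exists i, x = f i.
Proof.
have := tree_ofK (zfamily f); rewrite /zmem /elem /idx.
case: (tree_of (zfamily f)) => J g /of_treeP[gf fg]; split=> -[i ->].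
  have [j /of_treeP gfij] := gf i; exists j.
  by rewrite gfij tree_ofK.
have [j /of_treeP gfji] := fg i; exists j.
by rewrite gfji tree_ofK.
Qed.

Definition zempty : zfset := zfamily (fun v : False => match v with end).

Definition zsep (x : zfset) (P : zfset -> Prop) : zfset :=
  zfamily (fun i : {i : idx x | P (elem i)} => elem (sval i)).

Definition zpower (x : zfset) : zfset :=
  zfamily (fun P : idx x -> Prop =>
    zfamily (fun i : {i : idx x | P i} => elem (sval i))).

Definition zbigcup (F : nat -> zfset) : zfset :=
  zfamily (fun p : {k : nat & idx (F k)} => elem (projT2 p)).

Lemma zf_ext x y : (forall z, z ∈ x <-> z ∈ y) -> x = y.
Proof.
move=> xy; rewrite -(tree_ofK x) -(tree_ofK y); apply/of_treeP; move: xy.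
rewrite /zmem /elem /idx.
case: (tree_of x) => I f; case: (tree_of y) => J g /= fg; split=> [i|j].
  have /fg[j fgij] : exists j, of_tree (f i) = of_tree (f j) by exists i.
  by exists j; apply/of_treeP.
have /fg[i fgij] : exists i, of_tree (g j) = of_tree (g i) by exists j.
by exists i; apply/bisim_sym/of_treeP.
Qed.

Lemma mem_zempty x : ~ x ∈ zempty.
Proof. by move=> /mem_zfamily[]. Qed.

Lemma mem_zsep x P z : z ∈ zsep x P <-> z ∈ x /\ P z.
Proof.
split=> [/mem_zfamily[[i Pi] ->]|[[i ->] Pi]]; first by split=> //; exists i.
by apply/mem_zfamily; exists (exist _ i Pi).
Qed.

Lemma mem_zpower x z : z ∈ zpower x <-> z ⊆ x.
Proof.
split=> [/mem_zfamily[P ->] y /mem_zfamily[i ->]|zx]; first by exists (sval i).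
apply/mem_zfamily; exists (fun i => elem i ∈ z); apply: zf_ext => y.
split=> [yz|/mem_zfamily[[i iz] -> //]].
apply/mem_zfamily; have [i yE] := zx _ yz.
by rewrite yE in yz *; exists (exist _ i yz).
Qed.

Lemma mem_zbigcup F z : z ∈ zbigcup F <-> exists k, z ∈ F k.
Proof.
split=> [/mem_zfamily[[k i] ->]|[k [i ->]]]; first by exists k, i.
by apply/mem_zfamily; exists (existT _ k i).
Qed.

Lemma zmem_ind (P : zfset -> Prop) :
  (forall x, (forall y, y ∈ x -> P y) -> P x) -> forall x, P x.
Proof.
move=> IH x; rewrite -(tree_ofK x); elim: (tree_of x) => {x} I f Pf.
suff -> : of_tree (node f) = zfamily (fun i => of_tree (f i)).
  by apply: IH => y /mem_zfamily[i ->].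
by apply/of_treeP; split=> i; exists i; apply/of_treeP; rewrite tree_ofK.
Qed.

Lemma zf_pairing x y : exists p, forall z, z ∈ p <-> z = x \/ z = y.
Proof.
exists (zfamily (fun b : bool => if b then x else y)) => z.
split=> [/mem_zfamily[[] ->]|zxy]; [by left|by right|].
by apply/mem_zfamily; case: zxy => ->; [exists true|exists false].
Qed.

Lemma zf_union x : exists u, forall z, z ∈ u <-> exists2 y, y ∈ x & z ∈ y.
Proof.
exists (zfamily (fun p : {i : idx x & idx (elem i)} => elem (projT2 p))).
move=> z; split=> [/mem_zfamily[[i j] ->]|[_ [i ->] [j ->]]].
  by exists (elem i); [exists i|exists j].
by apply/mem_zfamily; exists (existT _ i j).
Qed.

Lemma zf_infinity :
  exists w, zempty ∈ w /\
    forall x, x ∈ w ->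
      exists2 s, s ∈ w & forall z, z ∈ s <-> z ∈ x \/ z = x.
Proof.
pose succ x := zfamily (fun o : option (idx x) => oapp (@elem x) x o).
exists (zfamily (fun n => iter n succ zempty)); split.
  by apply/mem_zfamily; exists 0.
move=> _ /mem_zfamily[n ->]; exists (iter n.+1 succ zempty).
  by apply/mem_zfamily; exists n.+1.
move=> z; split=> [/mem_zfamily[[i|] ->]|zn]; [by left; exists i|by right|].
by apply/mem_zfamily; case: zn => [[i ->]|->]; [exists (Some i)|exists None].
Qed.

Lemma zf_foundation x :
  x <> zempty -> exists2 y, y ∈ x & forall z, z ∈ y -> ~ z ∈ x.
Proof.
move=> x0; apply: contrapT => xN; apply: x0; apply: zf_ext => z.
split=> [zx|/mem_zempty//]; exfalso; move: z zx; apply: zmem_ind => y IH yx.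
by apply: xN; exists y.
Qed.

Lemma zf_replacement x (R : zfset -> zfset -> Prop) :
  (forall y z z', y ∈ x -> R y z -> R y z' -> z = z') ->
  exists w, forall z, z ∈ w <-> exists2 y, y ∈ x & R y z.
Proof.
move=> Rfun.
have [f fP] : {f : {i : idx x | exists z, R (elem i) z} -> zfset |
    forall i, R (elem (sval i)) (f i)}.
  exists (fun i => xget zempty [set z | R (elem (sval i)) z]) => -[i [z Riz]].
  by case: xgetP => //= /(_ z).
exists (zfamily f) => z; split=> [/mem_zfamily[i ->]|[_ [i ->] Riz]].
  by exists (elem (sval i)) => //; exists (sval i).
have Ri : exists z, R (elem i) z by exists z.
apply/mem_zfamily; exists (exist _ i Ri).
by apply: Rfun Riz (fP (exist _ i Ri)); exists i.
Qed.

Lemma zf_choice x :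
  (forall y, y ∈ x -> exists z, z ∈ y) ->
  (forall y y' z, y ∈ x -> y' ∈ x -> z ∈ y -> z ∈ y' -> y = y') ->
  exists c, forall y, y ∈ x -> exists! z, z ∈ y /\ z ∈ c.
Proof.
move=> x0 xdisj; have elemx i : @elem x i ∈ x by exists i.
pose f y := xget zempty [set z | z ∈ y].
have fP y : y ∈ x -> f y ∈ y.
  by move=> /x0[z zy]; rewrite /f; case: xgetP => // /(_ z).
exists (zfamily (fun i : idx x => f (elem i))) => y yx.
exists (f y); split=> [|z [zy /mem_zfamily[i zE]]].
  split; first exact: fP.
  by apply/mem_zfamily; have [i yE] := yx; exists i; rewrite -yE.
by rewrite zE; congr f; apply: (xdisj _ _ z) => //; rewrite zE; apply: fP.
Qed.

Definition trans_set (u : zfset) : Prop := forall y, y ∈ u -> y ⊆ u.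

Definition ordinal_set (a : zfset) : Prop :=
  trans_set a /\ forall y, y ∈ a -> trans_set y.

Definition SP (a : zfset) : zfset := zbigcup (fun k => iter k zpower a).

Fixpoint V (n : nat) : nat -> zfset :=
  fix Vn (k : nat) : zfset :=
    match k with
    | 0 => match n with
           | 0 => SP zempty
           | m.+1 => SP (zbigcup (V m))
           end
    | l.+1 => SP (Vn l)
    end.

Definition U (n : nat) : zfset := zbigcup (V n).

Lemma V00 : V 0 0 = SP zempty. Proof. by []. Qed.
Lemma VnS n k : V n k.+1 = SP (V n k). Proof. by case: n. Qed.
Lemma VS0 n : V n.+1 0 = SP (U n). Proof. by []. Qed.

(* Main.v *)
Require Import Defs.
From mathcomp Require Import all_boot.
From mathcomp Require Import boolp classical_sets functions cardinality.

(** Each [U n] is the result of applying power sets and countable unions to the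
    empty set, countably often.  Two properties of a set [A] pass through both
    operations: being transitive, and having only countably many ordinals as
    members.  Transitivity passes for elementary reasons, and countability
    passes through countable unions.  Countability passes through the power
    set because of trichotomy: if [A] is transitive, its ordinals form an
    ordinal [ordinals A], an ordinal that is a subset of [A] is a subset of
    [ordinals A], and so it is a member of [ordinals A] or equal to it.  Thus
    passing from [A] to its power set adds just one ordinal
    ([ordinal_zpower]), although it may add uncountably many sets.

    Hence [ordinals (U n)] is an ordinal with countably many members.  It is
    infinite because the one new ordinal does appear: [ordinals (V n k)] is a
    member of [V n k.+1], and [V n k] increases with [k], so these ordinals
    form a strictly increasing sequence of members of [U n]. *)

Set Implicit Arguments.
Unset Strict Implicit.
Unset Printing Implicit Defensive.

Local Open Scope classical_set_scope.
Local Open Scope card_scope.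

Notation ordinals A := (zsep A ordinal_set).

Lemma zmem_irr x : ~ x ∈ x.
Proof. by elim/zmem_ind: x => x IH xx; apply: (IH x). Qed.

Lemma ordinal_mem a x : ordinal_set a -> x ∈ a -> ordinal_set x.
Proof.
by move=> [ta tra] xa; split=> [|y yx]; apply: tra => //; exact: ta yx.
Qed.

Lemma ordinals_ordinal A : trans_set A -> ordinal_set (ordinals A).
Proof.
move=> tA; split=> [x|x] /mem_zsep[xA ox]; last by case: ox.
move=> y yx; apply/mem_zsep; split; first exact: tA yx.
exact: ordinal_mem yx.
Qed.

(** If neither of [a] and [b] is a member of the other, induction shows that
    they have the same members: a member [x] of [a] is comparable with [b], and
    both [x = b] and [b ∈ x] would put [b] in the transitive set [a]. *)
Lemma ordinal_trichotomy a b : ordinal_set a -> ordinal_set b ->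
  [\/ a ∈ b, a = b | b ∈ a].
Proof.
elim/zmem_ind: a b => a IHa; elim/zmem_ind => b IHb oa ob.
have [ab|nab] := pselect (a ∈ b); first exact: Or31.
have [ba|nba] := pselect (b ∈ a); first exact: Or33.
apply: Or32; apply: zf_ext => x; split=> [xa|xb].
  have [//|xE|bx] := IHa x xa b (ordinal_mem oa xa) ob.
    by case: nba; rewrite -xE.
  by case: nba; exact: (oa.1 x).
have [ax|xE|//] := IHb x xb oa (ordinal_mem ob xb).
  by case: nab; exact: (ob.1 x).
by case: nab; rewrite xE.
Qed.

Lemma ordinal_subset a b : ordinal_set a -> ordinal_set b ->
  a ⊆ b -> a ∈ b \/ a = b.
Proof.
move=> oa ob ab; have [|->|ba] := ordinal_trichotomy oa ob; [by left|by right|].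
by case: (@zmem_irr b); exact: ab.
Qed.

Lemma ordinal_zpower A a : trans_set A -> ordinal_set a ->
  a ∈ zpower A -> a ∈ A \/ a = ordinals A.
Proof.
move=> tA oa /mem_zpower aA.
have aoA : a ⊆ ordinals A.
  by move=> x xa; apply/mem_zsep; split; [exact: aA|exact: ordinal_mem xa].
have [/mem_zsep[]|] := ordinal_subset oa (ordinals_ordinal tA) aoA.
  by left.
by right.
Qed.

(** Transitivity of [A] is what makes the countability of its ordinals pass to
    [zpower A], so an induction has to carry the two properties together. *)
Definition trans_countable A :=
  trans_set A /\ countable [set x | x ∈ ordinals A].

Lemma trans_countable_zempty : trans_countable zempty.
Proof.
split=> [y /mem_zempty//|]; suff -> : [set x | x ∈ ordinals zempty] = set0.
  exact: countable0.
by apply/seteqP; split=> // x /mem_zsep[/mem_zempty].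
Qed.

Lemma trans_countable_zpower A :
  trans_countable A -> trans_countable (zpower A).
Proof.
move=> [tA cA]; split=> [y /mem_zpower yA z /yA/tA zA|]; first exact/mem_zpower.
apply: (@sub_countable _ _ _
  ([set x | x ∈ ordinals A] `|` [set ordinals A])).
  apply: subset_card_le => x /mem_zsep[xPA ox].
  have [xA|->] := ordinal_zpower tA ox xPA; last by right.
  by left; apply/mem_zsep.
by rewrite -bigcup2E; apply: bigcup_countable => // -[|[|i]] _ /=.
Qed.

Lemma trans_countable_zbigcup F :
  (forall k, trans_countable (F k)) -> trans_countable (zbigcup F).
Proof.
move=> tcF; split=> [y /mem_zbigcup[k yF] z zy|].
  by apply/mem_zbigcup; exists k; exact: (tcF k).1 zy.
suff -> : [set x | x ∈ ordinals (zbigcup F)] =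
    \bigcup_k [set x | x ∈ ordinals (F k)].
  by apply: bigcup_countable => // k _; exact: (tcF k).2.
apply/seteqP; split=> [x /mem_zsep[/mem_zbigcup[k xF] ox]|x [k _]].
  by exists k => //; apply/mem_zsep.
move=> /mem_zsep[xF ox]; apply/mem_zsep; split=> //.
by apply/mem_zbigcup; exists k.
Qed.

Lemma trans_countable_SP A : trans_countable A -> trans_countable (SP A).
Proof.
move=> tcA; apply: trans_countable_zbigcup; elim=> [//|k IH].
exact: trans_countable_zpower.
Qed.

Lemma trans_countable_V n k : trans_countable (V n k).
Proof.
elim: n k => [|n IHn]; elim=> [|k IHk].
- exact/trans_countable_SP/trans_countable_zempty.
- exact: trans_countable_SP.
- exact/trans_countable_SP/trans_countable_zbigcup.
- exact: trans_countable_SP.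
Qed.

Lemma subset_SP A : A ⊆ SP A.
Proof. by move=> x xA; apply/mem_zbigcup; exists 0. Qed.

Lemma zpower_subset_SP A : zpower A ⊆ SP A.
Proof. by move=> x xA; apply/mem_zbigcup; exists 1. Qed.

Lemma subset_V n j k : j <= k -> V n j ⊆ V n k.
Proof.
move=> /subnK <-; elim: (k - j) => [//|i IH] x /IH.
by rewrite addSn VnS; exact: subset_SP.
Qed.

Lemma ordinals_V_mem n j k : j < k -> ordinals (V n j) ∈ ordinals (V n k).
Proof.
move=> jk; apply/mem_zsep; split; last first.
  exact/ordinals_ordinal/(trans_countable_V n j).1.
apply: (subset_V jk); rewrite VnS; apply/zpower_subset_SP/mem_zpower.
by move=> x /mem_zsep[].
Qed.

Lemma infinite_ordinals_U n : infinite_set [set x | x ∈ ordinals (U n)].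
Proof.
have V_inj : injective (fun k => ordinals (V n k)).
  move=> j k /= jkE; apply/eqP.
  apply: contra_notT (@zmem_irr (ordinals (V n j))).
  by rewrite neq_ltn => /orP[]/(ordinals_V_mem n); rewrite -jkE.
apply/infiniteP; rewrite -(card_le_eql (inj_card_eq (in2W V_inj))).
apply: subset_card_le => _ [k _ <-].
have /mem_zsep[oV ?] := ordinals_V_mem n (ltnSn k).
by apply/mem_zsep; split=> //; apply/mem_zbigcup; exists k.+1.
Qed.

Theorem theorem5p4 (n : nat) :
  ordinal_set (zsep (U n) ordinal_set) /\
  [set x : zfset | zmem x (zsep (U n) ordinal_set)] #= [set: nat].
Proof.
have [tU cU] := trans_countable_zbigcup (trans_countable_V n).
split; first exact: ordinals_ordinal.
exact: eq_card_nat cU (@infinite_ordinals_U n).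
Qed.
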